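(* Let $(M,d)$ be a metric space and $n\geq 2$. The construction $\mathrm{Sym}:\mathbb{S}_n(M)\to\mathrm{Span}(\mathbf{Grp})$ (defined in the context on objects, 1-cells and 2-cells) is a normal lax functor.
   Context: $\mathcal{S}_n(M)$ is the category whose objects are the $n$-configurations of $M$ (subsets of $n$ distinct points) and whose morphisms $f:X\to Y$ are bijections that are restrictions of homeomorphisms $\tilde f:M\to M$ with $\tilde f(X)=Y$. $\mathrm{Sym}(X)=\{\pi\in\mathrm{Iso}(M)\mid\pi(X)=X\}$, its elements being regarded as permutations of $X$ (via restriction to $X$). For $f:X\to Y$ in $\mathcal{S}_n(M)$, $\mathrm{Sym}_f(X)=\{\sigma\in\mathrm{Sym}(X)\mid f\circ\sigma\circ f^{-1}\in\mathrm{Sym}(Y)\}$, and $f^\sharp:\mathrm{Sym}_f(X)\to\mathrm{Sym}(Y)$, $f^\sharp(\sigma)=f\circ\sigma\circ f^{-1}$. The path 2-category $\mathbb{S}_n(M)$: objects are the $n$-configurations; a 1-cell $\gamma:X\to Y$ is a finite path of composable morphisms $X=X_0\xrightarrow{f_1}X_1\to\cdots\xrightarrow{f_k}X_k=Y$ of $\mathcal{S}_n(M)$, composition is concatenation (written $\star$), and the identity 1-cell is the empty path; 2-cells are contractions of paths: for composable $f,g$ there is a generating 2-cell $\alpha_{f,g}:(f,g)\Rightarrow(g\circ f)$, general 2-cells are generated by these under composition, and formally a (non-identity) 2-cell $\gamma\Rightarrow\gamma'$ exists if and only if $\gamma'$ is obtained from $\gamma$ by replacing consecutive morphisms $(f_i,f_{i+1})$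 by $f_{i+1}\circ f_i$ one or more times. $\mathrm{Span}(\mathbf{Grp})$ is the bicategory with groups as objects, spans of group homomorphisms $X\leftarrow Z\to Y$ as 1-cells, composition by pullback, and homomorphisms of apexes commuting with the legs as 2-cells. The construction $\mathrm{Sym}$: on objects $X\mapsto\mathrm{Sym}(X)$. A path $\gamma=(X_0\xrightarrow{f_1}\cdots\xrightarrow{f_k}X_k)$ goes to the span $\mathrm{Sym}(X_0)\xleftarrow{\gamma^\flat}G_\gamma\xrightarrow{\gamma^\sharp}\mathrm{Sym}(X_k)$, where $$G_\gamma=\Big\{(\sigma_0,\dots,\sigma_{k-1})\in\prod_{i=0}^{k-1}\mathrm{Sym}_{f_{i+1}}(X_i)\ \Big|\ f_{i+1}^\sharp(\sigma_i)=\sigma_{i+1}\text{ for }0\le i\le k-2\Big\},$$ $\gamma^\flat(\sigma_0,\dots,\sigma_{k-1})=\sigma_0$, $\gamma^\sharp(\sigma_0,\dots,\sigma_{k-1})=f_k^\sharp(\sigma_{k-1})$; the empty path at $X$ goes to the span with apex $\mathrm{Sym}(X)$ and identity legs. The 2-cell $\alpha:(f,g)\Rightarrow g\circ f$ (with $f:X\to Y$, $g:Y\to Z$) goes to the canonical inclusion $\mathrm{Sym}_f(X)\times_{\mathrm{Sym}(Y)}\mathrm{Sym}_g(Y)\hookrightarrow\mathrm{Sym}_{g\circ f}(X)$ of apexes. A lax functor is normal if it preserves identity 1-cells strictly (identity constraints are identities). *)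

(* Defs.v *)
From HB Require Import structures.
From mathcomp Require Import all_boot all_fingroup.
From mathcomp Require Import finmap.
From mathcomp Require Import all_classical all_reals topology.

Set Implicit Arguments.
Unset Strict Implicit.
Unset Printing Implicit Defensive.

Local Open Scope group_scope.

(* Both compositions are written in diagrammatic order. *)
Record bicat := Bicat {
  ob :> Type;
  hom : ob -> ob -> Type;
  cell : forall a b, hom a b -> hom a b -> Type;
  id1 : forall a, hom a a;
  comp1 : forall a b c, hom a b -> hom b c -> hom a c;
  id2 : forall a b (f : hom a b), cell f f;
  vcomp : forall a b (f g h : hom a b), cell f g -> cell g h -> cell f h;
  hcomp : forall a b c (f f' : hom a b) (g g' : hom b c),
    cell f f' -> cell g g' -> cell (comp1 f g) (comp1 f' g');
  asc : forall a b c d (f : hom a b) (g : hom b c) (h : hom c d),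
    cell (comp1 (comp1 f g) h) (comp1 f (comp1 g h));
  ascV : forall a b c d (f : hom a b) (g : hom b c) (h : hom c d),
    cell (comp1 f (comp1 g h)) (comp1 (comp1 f g) h);
  lun : forall a b (f : hom a b), cell (comp1 (id1 a) f) f;
  lunV : forall a b (f : hom a b), cell f (comp1 (id1 a) f);
  run : forall a b (f : hom a b), cell (comp1 f (id1 b)) f;
  runV : forall a b (f : hom a b), cell f (comp1 f (id1 b));
  vcomp1c : forall a b (f g : hom a b) (u : cell f g), vcomp (id2 f) u = u;
  vcompc1 : forall a b (f g : hom a b) (u : cell f g), vcomp u (id2 g) = u;
  vcompA : forall a b (f g h k : hom a b)
    (u : cell f g) (v : cell g h) (w : cell h k),
    vcomp u (vcomp v w) = vcomp (vcomp u v) w;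
  hcomp_id : forall a b c (f : hom a b) (g : hom b c),
    hcomp (id2 f) (id2 g) = id2 (comp1 f g);
  interchange : forall a b c (f f' f'' : hom a b) (g g' g'' : hom b c)
    (u : cell f f') (u' : cell f' f'') (v : cell g g') (v' : cell g' g''),
    hcomp (vcomp u u') (vcomp v v') = vcomp (hcomp u v) (hcomp u' v');
  asc_nat : forall a b c d (f f' : hom a b) (g g' : hom b c) (h h' : hom c d)
    (u : cell f f') (v : cell g g') (w : cell h h'),
    vcomp (hcomp (hcomp u v) w) (asc f' g' h')
    = vcomp (asc f g h) (hcomp u (hcomp v w));
  ascK : forall a b c d (f : hom a b) (g : hom b c) (h : hom c d),
    vcomp (asc f g h) (ascV f g h) = id2 _;
  ascVK : forall a b c d (f : hom a b) (g : hom b c) (h : hom c d),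
    vcomp (ascV f g h) (asc f g h) = id2 _;
  lun_nat : forall a b (f f' : hom a b) (u : cell f f'),
    vcomp (hcomp (id2 (id1 a)) u) (lun f') = vcomp (lun f) u;
  lunK : forall a b (f : hom a b), vcomp (lun f) (lunV f) = id2 _;
  lunVK : forall a b (f : hom a b), vcomp (lunV f) (lun f) = id2 _;
  run_nat : forall a b (f f' : hom a b) (u : cell f f'),
    vcomp (hcomp u (id2 (id1 b))) (run f') = vcomp (run f) u;
  runK : forall a b (f : hom a b), vcomp (run f) (runV f) = id2 _;
  runVK : forall a b (f : hom a b), vcomp (runV f) (run f) = id2 _;
  pentagon : forall a b c d e
    (f : hom a b) (g : hom b c) (h : hom c d) (k : hom d e),
    vcomp (asc (comp1 f g) h k) (asc f g (comp1 h k))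
    = vcomp (hcomp (asc f g h) (id2 k))
        (vcomp (asc f (comp1 g h) k) (hcomp (id2 f) (asc g h k)));
  triangle : forall a b c (f : hom a b) (g : hom b c),
    vcomp (asc f (id1 b) g) (hcomp (id2 f) (lun g)) = hcomp (run f) (id2 g)
}.

(* The lax functors from B to C whose actions on objects and on 1-cells are the
   given maps F0 and F1. *)
Record lax_functor (B C : bicat) (F0 : B -> C)
    (F1 : forall a b : B, hom a b -> hom (F0 a) (F0 b)) := LaxFunctor {
  lax2 : forall (a b : B) (f g : hom a b), cell f g -> cell (F1 a b f) (F1 a b g);
  lax_unit : forall a : B, cell (id1 (F0 a)) (F1 a a (id1 a));
  lax_comp : forall (a b c : B) (f : hom a b) (g : hom b c),
    cell (comp1 (F1 a b f) (F1 b c g)) (F1 a c (comp1 f g));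
  lax2_id : forall (a b : B) (f : hom a b), lax2 (id2 f) = id2 (F1 a b f);
  lax2_vcomp : forall (a b : B) (f g h : hom a b) (u : cell f g) (v : cell g h),
    lax2 (vcomp u v) = vcomp (lax2 u) (lax2 v);
  lax_comp_nat : forall (a b c : B) (f f' : hom a b) (g g' : hom b c)
    (u : cell f f') (v : cell g g'),
    vcomp (hcomp (lax2 u) (lax2 v)) (lax_comp f' g')
    = vcomp (lax_comp f g) (lax2 (hcomp u v));
  lax_assoc : forall (a b c d : B) (f : hom a b) (g : hom b c) (h : hom c d),
    vcomp (hcomp (lax_comp f g) (id2 (F1 c d h)))
      (vcomp (lax_comp (comp1 f g) h) (lax2 (asc f g h)))
    = vcomp (asc (F1 a b f) (F1 b c g) (F1 c d h))
        (vcomp (hcomp (id2 (F1 a b f)) (lax_comp g h))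
           (lax_comp f (comp1 g h)));
  lax_lunit : forall (a b : B) (f : hom a b),
    vcomp (hcomp (lax_unit a) (id2 (F1 a b f)))
      (vcomp (lax_comp (id1 a) f) (lax2 (lun f)))
    = lun (F1 a b f);
  lax_runit : forall (a b : B) (f : hom a b),
    vcomp (hcomp (id2 (F1 a b f)) (lax_unit b))
      (vcomp (lax_comp f (id1 b)) (lax2 (run f)))
    = run (F1 a b f)
}.

Definition eq_cell (B : bicat) (a b : B) (f g : hom a b) (e : f = g) :
    cell f g :=
  match e in _ = h return cell f h with erefl => id2 f end.

Definition is_normal (B C : bicat) (F0 : B -> C)
    (F1 : forall a b : B, hom a b -> hom (F0 a) (F0 b))
    (F : lax_functor F1) : Prop :=
  forall a : B, exists e : id1 (F0 a) = F1 a a (id1 a),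
    lax_unit F a = eq_cell e.

Notation grp_hom := UMagmaMorphism.type.

Lemma grp_hom_eq (G H : groupType) (f g : grp_hom G H) : f =1 g -> f = g.
Proof.
case: f g => f [[f1] [f2]] [g [[g1] [g2]]] /= /funext fg.
by subst g; rewrite (Prop_irrelevance f1 g1) (Prop_irrelevance f2 g2).
Qed.

Lemma grp_homM (G H : groupType) (f : grp_hom G H) : {morph f : x y / x * y}.
Proof. exact: gmulfM. Qed.

Section MkHom.
Variables (G H : groupType) (f : G -> H) (fM : {morph f : x y / x * y}).

Lemma mk_hom1 : f 1 = 1.
Proof. by apply: (@mulgI _ (f 1)); rewrite -fM !mulg1. Qed.

Definition mk_hom : grp_hom G H :=
  HB.pack_for (grp_hom G H) f
    (isUMagmaMorphism.Build G H f (mk_hom1, fM)).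
End MkHom.

Section SubGroupType.
Variables (G : groupType) (P : pred G).

(* [PG] is a phantom argument supporting the group structure. The operations
   are given explicitly, rather than by SubChoice_isSubGroup, so that products
   in iterated pullbacks reduce cheaply. *)
Definition sub_grp (PG : group_closed P) := {x : G | P x}.

Variable PG : group_closed P.
HB.instance Definition _ := SubChoice.on (sub_grp PG).

Definition sub_mul (x y : sub_grp PG) : sub_grp PG :=
  exist _ (val x * val y) (group_closedM PG (valP x) (valP y)).
Definition sub_one : sub_grp PG := exist _ 1 PG.1.
Definition sub_inv (x : sub_grp PG) : sub_grp PG :=
  exist _ (val x)^-1 (group_closedV PG (valP x)).

Lemma sub_mulA : associative sub_mul.
Proof. by move=> x y z; apply/val_inj/mulgA. Qed.
Lemma sub_mul1 : left_id sub_one sub_mul.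
Proof. by move=> x; apply/val_inj/mul1g. Qed.
Lemma sub_1mul : right_id sub_one sub_mul.
Proof. by move=> x; apply/val_inj/mulg1. Qed.
Lemma sub_mulV : left_inverse sub_one sub_inv sub_mul.
Proof. by move=> x; apply/val_inj/mulVg. Qed.
Lemma sub_Vmul : right_inverse sub_one sub_inv sub_mul.
Proof. by move=> x; apply/val_inj/mulgV. Qed.

HB.instance Definition _ := isGroup.Build (sub_grp PG)
  sub_mulA sub_mul1 sub_1mul sub_mulV sub_Vmul.
End SubGroupType.

Record span (G H : groupType) := Span {
  apex : groupType;
  lleg : grp_hom apex G;
  rleg : grp_hom apex H
}.

Record span_cell (G H : groupType) (s t : span G H) := SpanCell {
  span_map :> grp_hom (apex s) (apex t);
  span_mapl : forall x, lleg t (span_map x) = lleg s x;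
  span_mapr : forall x, rleg t (span_map x) = rleg s x
}.

Lemma span_cell_eq (G H : groupType) (s t : span G H) (u v : span_cell s t) :
  u =1 v -> u = v.
Proof.
case: u v => [u ul ur] [v vl vr] /= /grp_hom_eq uv; subst v.
by rewrite (Prop_irrelevance ul vl) (Prop_irrelevance ur vr).
Qed.

Definition id_hom (G : groupType) : grp_hom G G :=
  @mk_hom G G id (fun x y => erefl).

Definition span_id (G : groupType) : span G G := Span (id_hom G) (id_hom G).

Section SpanComp.
Variables (G H K : groupType) (s : span G H) (t : span H K).

Definition pb_pred : pred (apex s * apex t)%type :=
  fun p => rleg s p.1 == lleg t p.2.

Lemma pb_closed : group_closed pb_pred.
Proof.
split=> [|x y]; rewrite !unfold_in /pb_pred /= ?gmulf1 //.
by move=> /eqP xE /eqP yE; rewrite !gmulfF xE yE.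
Qed.

Definition pullback : groupType := sub_grp pb_closed.

Definition pb_left : grp_hom pullback G :=
  @mk_hom pullback G (fun p => lleg s (val p).1)
    (fun x y => grp_homM (lleg s) (val x).1 (val y).1).
Definition pb_right : grp_hom pullback K :=
  @mk_hom pullback K (fun p => rleg t (val p).2)
    (fun x y => grp_homM (rleg t) (val x).2 (val y).2).

Definition span_comp : span G K := Span pb_left pb_right.
End SpanComp.

Section MkCell.
Variables (G H : groupType) (s t : span G H) (m : apex s -> apex t).
Variables (mM : {morph m : x y / x * y})
  (ml : forall x, lleg t (m x) = lleg s x)
  (mr : forall x, rleg t (m x) = rleg s x).
Definition mk_cell : span_cell s t := @SpanCell G H s t (mk_hom mM) ml mr.
End MkCell.

Section MkPb.
Variables (G H K : groupType) (s : span G H) (t : span H K).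

Definition mk_pb (x : apex s) (y : apex t) (e : rleg s x = lleg t y) :
  apex (span_comp s t) := exist (fun p => pb_pred p) (x, y) (introT eqP e).

Lemma pbP (p : apex (span_comp s t)) : rleg s (val p).1 = lleg t (val p).2.
Proof. exact/eqP/(valP p). Qed.

Lemma pb_ext (p q : apex (span_comp s t)) :
  (val p).1 = (val q).1 -> (val p).2 = (val q).2 -> p = q.
Proof. by move=> e1 e2; apply/val_inj/eqP; apply/andP; split; apply/eqP. Qed.

End MkPb.

Definition span_id2 (G H : groupType) (s : span G H) : span_cell s s :=
  @mk_cell _ _ s s id (fun x y => erefl) (fun x => erefl) (fun x => erefl).

Section SpanVcomp.
Variables (G H : groupType) (s t u : span G H).
Variables (a : span_cell s t) (b : span_cell t u).

Lemma span_vcompM : {morph (fun x => b (a x)) : x y / x * y}.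
Proof. by move=> x y; rewrite !gmulfM. Qed.
Lemma span_vcompl x : lleg u (b (a x)) = lleg s x.
Proof. by rewrite !span_mapl. Qed.
Lemma span_vcompr x : rleg u (b (a x)) = rleg s x.
Proof. by rewrite !span_mapr. Qed.

Definition span_vcomp : span_cell s u :=
  mk_cell span_vcompM span_vcompl span_vcompr.
End SpanVcomp.

Section SpanHcomp.
Variables (G H K : groupType) (s s' : span G H) (t t' : span H K).
Variables (a : span_cell s s') (b : span_cell t t').

Lemma span_hcompP (p : apex (span_comp s t)) :
  rleg s' (a (val p).1) = lleg t' (b (val p).2).
Proof. by rewrite span_mapr span_mapl pbP. Qed.

Definition span_hmap (p : apex (span_comp s t)) : apex (span_comp s' t') :=
  mk_pb (span_hcompP p).

Lemma span_hmapM : {morph span_hmap : x y / x * y}.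
Proof. by move=> x y; apply: pb_ext; exact: grp_homM. Qed.

Definition span_hcomp : span_cell (span_comp s t) (span_comp s' t') :=
  @mk_cell _ _ (span_comp s t) (span_comp s' t') span_hmap span_hmapM
    (fun p => span_mapl a (val p).1) (fun p => span_mapr b (val p).2).
End SpanHcomp.

Section SpanAssoc.
Variables (G H K L : groupType).
Variables (s : span G H) (t : span H K) (u : span K L).
Local Notation st_u := (span_comp (span_comp s t) u).
Local Notation s_tu := (span_comp s (span_comp t u)).

Lemma span_ascP1 (p : apex st_u) : rleg t (val (val p).1).2 = lleg u (val p).2.
Proof. exact: (pbP p). Qed.
Lemma span_ascP2 (p : apex st_u) :
  rleg s (val (val p).1).1 = lleg (span_comp t u) (mk_pb (span_ascP1 p)).
Proof. exact: (pbP (val p).1). Qed.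

Definition span_amap (p : apex st_u) : apex s_tu := mk_pb (span_ascP2 p).

Lemma span_amapM : {morph span_amap : x y / x * y}.
Proof. by move=> x y; apply: pb_ext => //; apply: pb_ext. Qed.

Definition span_asc : span_cell st_u s_tu :=
  @mk_cell _ _ st_u s_tu span_amap span_amapM (fun _ => erefl) (fun _ => erefl).

Lemma span_ascVP1 (p : apex s_tu) : rleg s (val p).1 = lleg t (val (val p).2).1.
Proof. exact: (pbP p). Qed.
Lemma span_ascVP2 (p : apex s_tu) :
  rleg (span_comp s t) (mk_pb (span_ascVP1 p)) = lleg u (val (val p).2).2.
Proof. exact: (pbP (val p).2). Qed.

Definition span_amapV (p : apex s_tu) : apex st_u := mk_pb (span_ascVP2 p).

Lemma span_amapVM : {morph span_amapV : x y / x * y}.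
Proof. by move=> x y; apply: pb_ext => //; apply: pb_ext. Qed.

Definition span_ascV : span_cell s_tu st_u :=
  @mk_cell _ _ s_tu st_u span_amapV span_amapVM
    (fun _ => erefl) (fun _ => erefl).

Lemma span_ascK : span_vcomp span_asc span_ascV = span_id2 st_u.
Proof.
by apply: span_cell_eq => p; apply: pb_ext => //; apply: (@pb_ext _ _ _ s t).
Qed.
Lemma span_ascVK : span_vcomp span_ascV span_asc = span_id2 s_tu.
Proof.
by apply: span_cell_eq => p; apply: pb_ext => //; apply: (@pb_ext _ _ _ t u).
Qed.
End SpanAssoc.

Section SpanUnits.
Variables (G H : groupType) (s : span G H).
Local Notation ls := (span_comp (span_id G) s).
Local Notation rs := (span_comp s (span_id H)).

Lemma span_lunl (p : apex ls) : lleg s (val p).2 = lleg ls p.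
Proof. by rewrite -(pbP p). Qed.
Definition span_lun : span_cell ls s :=
  @mk_cell _ _ ls s (fun p => (val p).2) (fun _ _ => erefl)
    span_lunl (fun _ => erefl).

Definition span_lmapV (x : apex s) : apex ls :=
  @mk_pb _ _ _ (span_id G) s (lleg s x) x erefl.
Lemma span_lmapVM : {morph span_lmapV : x y / x * y}.
Proof. by move=> x y; apply: pb_ext => //; exact: grp_homM. Qed.
Definition span_lunV : span_cell s ls :=
  @mk_cell _ _ s ls span_lmapV span_lmapVM (fun _ => erefl) (fun _ => erefl).

Lemma span_runr (p : apex rs) : rleg s (val p).1 = rleg rs p.
Proof. by rewrite (pbP p). Qed.
Definition span_run : span_cell rs s :=
  @mk_cell _ _ rs s (fun p => (val p).1) (fun _ _ => erefl)
    (fun _ => erefl) span_runr.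

Definition span_rmapV (x : apex s) : apex rs :=
  @mk_pb _ _ _ s (span_id H) x (rleg s x) erefl.
Lemma span_rmapVM : {morph span_rmapV : x y / x * y}.
Proof. by move=> x y; apply: pb_ext => //; exact: grp_homM. Qed.
Definition span_runV : span_cell s rs :=
  @mk_cell _ _ s rs span_rmapV span_rmapVM (fun _ => erefl) (fun _ => erefl).

Lemma span_lunK : span_vcomp span_lun span_lunV = span_id2 ls.
Proof.
by apply: span_cell_eq => p; apply: (@pb_ext _ _ _ (span_id G) s) => //;
  exact/esym/(pbP p).
Qed.
Lemma span_runK : span_vcomp span_run span_runV = span_id2 rs.
Proof.
by apply: span_cell_eq => p; apply: (@pb_ext _ _ _ s (span_id H)) => //;
  exact: (pbP p).
Qed.
End SpanUnits.

Lemma span_asc_nat (G H K L : groupType) (s s' : span G H) (t t' : span H K)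
    (u u' : span K L)
    (a : span_cell s s') (b : span_cell t t') (c : span_cell u u') :
  span_vcomp (span_hcomp (span_hcomp a b) c) (span_asc s' t' u')
  = span_vcomp (span_asc s t u) (span_hcomp a (span_hcomp b c)).
Proof.
apply: span_cell_eq => p; apply: (@pb_ext _ _ _ s' (span_comp t' u')) => //.
exact: (@pb_ext _ _ _ t' u').
Qed.

Lemma span_pentagon (G H K L M : groupType) (s : span G H) (t : span H K)
    (u : span K L) (v : span L M) :
  span_vcomp (span_asc (span_comp s t) u v) (span_asc s t (span_comp u v))
  = span_vcomp (span_hcomp (span_asc s t u) (span_id2 v))
      (span_vcomp (span_asc s (span_comp t u) v)
         (span_hcomp (span_id2 s) (span_asc t u v))).
Proof.
apply: span_cell_eq => p.
apply: (@pb_ext _ _ _ s (span_comp t (span_comp u v))) => //.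
apply: (@pb_ext _ _ _ t (span_comp u v)) => //.
exact: (@pb_ext _ _ _ u v).
Qed.

Lemma span_triangle (G H K : groupType) (s : span G H) (t : span H K) :
  span_vcomp (span_asc s (span_id H) t) (span_hcomp (span_id2 s) (span_lun t))
  = span_hcomp (span_run s) (span_id2 t).
Proof. by apply: span_cell_eq => p; exact: pb_ext. Qed.

Lemma span_hcomp_id (G H K : groupType) (s : span G H) (t : span H K) :
  span_hcomp (span_id2 s) (span_id2 t) = span_id2 (span_comp s t).
Proof. by apply: span_cell_eq => p; exact: pb_ext. Qed.

Lemma span_interchange (G H K : groupType) (s s' s'' : span G H)
    (t t' t'' : span H K) (a : span_cell s s') (a' : span_cell s' s'')
    (b : span_cell t t') (b' : span_cell t' t'') :
  span_hcomp (span_vcomp a a') (span_vcomp b b')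
  = span_vcomp (span_hcomp a b) (span_hcomp a' b').
Proof. by apply: span_cell_eq => p; exact: pb_ext. Qed.

Definition SpanGrp : bicat.
Proof.
refine (@Bicat groupType span span_cell span_id span_comp span_id2 span_vcomp
  span_hcomp span_asc span_ascV span_lun span_lunV span_run span_runV
  _ _ _ span_hcomp_id span_interchange span_asc_nat span_ascK span_ascVK
  _ span_lunK _ _ span_runK _ span_pentagon span_triangle).
all: by move=> *; exact: span_cell_eq.
Defined.

Lemma unit_mulA : associative (fun _ _ : unit => tt). Proof. by []. Qed.
Lemma unit_mul1 : left_id tt (fun _ _ : unit => tt). Proof. by case. Qed.
Lemma unit_1mul : right_id tt (fun _ _ : unit => tt). Proof. by case. Qed.
Lemma unit_mulV : left_inverse tt (fun _ => tt) (fun _ _ : unit => tt).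
Proof. by []. Qed.
Lemma unit_Vmul : right_inverse tt (fun _ => tt) (fun _ _ : unit => tt).
Proof. by []. Qed.
Definition unit_grp : groupType := HB.pack_for groupType unit
  (isGroup.Build unit unit_mulA unit_mul1 unit_1mul unit_mulV unit_Vmul).

Section Configurations.
Variables (R : realType) (M : metricType R) (n : nat).

Record config := Config {
  pts :> {fset M};
  card_pts : #|` pts| = n
}.

Definition homeomorphism (phi : M -> M) : Prop :=
  continuous phi /\
  exists psi : M -> M,
    [/\ continuous psi, cancel phi psi & cancel psi phi].

Definition isometry (phi : M -> M) : Prop :=
  bijective phi /\ forall x y : M, mdist (phi x) (phi y) = mdist x y.

Definition maps_onto (phi : M -> M) (X Y : config) : Prop :=
  (phi @` [set` pts X] = [set` pts Y])%classic.

Record mor (X Y : config) := Mor {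
  mor_fun :> X -> Y;
  mor_bij : bijective mor_fun;
  mor_homeo : exists phi : M -> M,
    [/\ homeomorphism phi, maps_onto phi X Y &
        forall x : X, phi (val x) = val (mor_fun x)]
}.

Lemma mor_comp_homeo (X Y Z : config) (g : mor Y Z) (f : mor X Y) :
  exists phi : M -> M,
    [/\ homeomorphism phi, maps_onto phi X Z &
        forall x : X, phi (val x) = val (g (f x))].
Proof.
have [phi [[cp [pi [cpi pK piK]]] pXY pf]] := mor_homeo f.
have [psi [[cs [si [csi sK siK]]] sYZ sg]] := mor_homeo g.
exists (psi \o phi); split.
- split; first by move=> x; apply: continuous_comp; [exact: cp | exact: cs].
  exists (pi \o si); split.
  + by move=> x; apply: continuous_comp; [exact: csi | exact: cpi].
  + exact: can_comp.
  + exact: can_comp.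
- by rewrite /maps_onto -sYZ -pXY image_comp.
- by move=> x /=; rewrite pf sg.
Qed.

Definition mor_comp (X Y Z : config) (g : mor Y Z) (f : mor X Y) : mor X Z :=
  @Mor X Z (g \o f) (bij_comp (mor_bij g) (mor_bij f)) (mor_comp_homeo g f).

Lemma mor_surj (X Y : config) (f : mor X Y) (y : Y) : y \in codom f.
Proof. by have [g _ gK] := mor_bij f; apply/codomP; exists (g y). Qed.

Definition mor_inv (X Y : config) (f : mor X Y) (y : Y) : X :=
  iinv (mor_surj f y).

Lemma mor_invK (X Y : config) (f : mor X Y) : cancel (mor_inv f) f.
Proof. by move=> y; exact: f_iinv. Qed.

Lemma mor_funK (X Y : config) (f : mor X Y) : cancel f (mor_inv f).
Proof. by move=> x; apply: (bij_inj (mor_bij f)); rewrite mor_invK. Qed.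

Lemma conj_inj (X Y : config) (f : mor X Y) (s : {perm X}) :
  injective (fun y => f (s (mor_inv f y))).
Proof.
move=> y z /(bij_inj (mor_bij f)) /perm_inj.
exact: (can_inj (mor_invK f)).
Qed.

Definition mor_conj (X Y : config) (f : mor X Y) (s : {perm X}) : {perm Y} :=
  perm (@conj_inj X Y f s).

Lemma mor_conj1 (X Y : config) (f : mor X Y) : mor_conj f 1 = 1.
Proof. by apply/permP => y; rewrite permE !perm1 mor_invK. Qed.

Lemma mor_conjM (X Y : config) (f : mor X Y) :
  {morph mor_conj f : s t / s * t}.
Proof. by move=> s t; apply/permP => y; rewrite !(permE, permM) mor_funK. Qed.

(* Elements of Iso(M) preserving X are identified when they agree on X. The
   product of {perm X} is composition in diagrammatic order:
   (s * t) x = t (s x). *)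
Definition Sym_set (X : config) : {set {perm X}} :=
  [set s : {perm X} | `[< exists phi : M -> M,
    [/\ isometry phi, maps_onto phi X X &
        forall x : X, phi (val x) = val (s x)] >]].

Lemma Sym_group_set (X : config) : group_set (Sym_set X).
Proof.
apply/group_setP; split=> [|s t].
  rewrite !inE; exists id; split=> [||x]; last by rewrite perm1.
    by split=> //; exists id.
  exact: image_id.
rewrite !inE => -[phi [[bp ip] pX ps]] [psi [[bq iq] qX qt]].
exists (psi \o phi); split=> [||x] /=.
- by split; [exact: bij_comp | move=> x y /=; rewrite iq ip].
- by rewrite /maps_onto -[RHS]qX -[in RHS]pX image_comp.
- by rewrite permM ps qt.
Qed.
Definition Sym (X : config) : {group {perm X}} := group (Sym_group_set X).

Definition Symf_set (X Y : config) (f : mor X Y) : {set {perm X}} :=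
  [set s in Sym X | mor_conj f s \in Sym Y].

Lemma Symf_group_set (X Y : config) (f : mor X Y) : group_set (Symf_set f).
Proof.
apply/group_setP; split=> [|s t].
  by apply/setIdP; rewrite mor_conj1 !group1.
move=> /setIdP[sX sY] /setIdP[tX tY].
by apply/setIdP; rewrite mor_conjM !groupM.
Qed.
Definition Symf (X Y : config) (f : mor X Y) : {group {perm X}} :=
  group (Symf_group_set f).

Definition SymG (X : config) : groupType := subg_of (Sym X).
Definition SymfG (X Y : config) (f : mor X Y) : groupType := subg_of (Symf f).

Lemma Symf_sub (X Y : config) (f : mor X Y) (s : SymfG f) : sgval s \in Sym X.
Proof. by have /setIdP[] := subgP s. Qed.

Lemma Symf_conj (X Y : config) (f : mor X Y) (s : SymfG f) :
  mor_conj f (sgval s) \in Sym Y.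
Proof. by have /setIdP[] := subgP s. Qed.

Definition Symf_incl (X Y : config) (f : mor X Y) (s : SymfG f) : SymG X :=
  Subg (Symf_sub s).

(* f^sharp(s) = f o s o f^-1 *)
Definition sharp (X Y : config) (f : mor X Y) (s : SymfG f) : SymG Y :=
  Subg (Symf_conj s).

Lemma Symf_inclM (X Y : config) (f : mor X Y) :
  {morph @Symf_incl X Y f : s t / s * t}.
Proof. by move=> s t; apply: val_inj. Qed.

Lemma sharpM (X Y : config) (f : mor X Y) : {morph @sharp X Y f : s t / s * t}.
Proof. by move=> s t; apply: val_inj; exact: mor_conjM. Qed.

Inductive gpath : config -> config -> Type :=
| pnil X : gpath X X
| pcons X Y Z : mor X Y -> gpath Y Z -> gpath X Z.

Fixpoint pcat X Y Z (p : gpath X Y) : gpath Y Z -> gpath X Z :=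
  match p in gpath X Y return gpath Y Z -> gpath X Z with
  | pnil _ => id
  | pcons _ _ _ f p' => fun q => pcons f (pcat p' q)
  end.

Definition path1 X Y (f : mor X Y) : gpath X Y := pcons f (pnil Y).
Definition path2 X Y Z (f : mor X Y) (g : mor Y Z) : gpath X Z :=
  pcons f (path1 g).

Inductive contract1 : forall X Y, gpath X Y -> gpath X Y -> Prop :=
| contract_here X Y Z W (f : mor X Y) (g : mor Y Z) (p : gpath Z W) :
    contract1 (pcons f (pcons g p)) (pcons (mor_comp g f) p)
| contract_there X Y Z (f : mor X Y) (p q : gpath Y Z) :
    contract1 p q -> contract1 (pcons f p) (pcons f q).

(* The 2-cells: a path is obtained from another one by finitely many (possibly
   zero) contractions. As propositions, parallel 2-cells are equal. *)
Inductive contracts X Y : gpath X Y -> gpath X Y -> Prop :=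
| contracts_refl p : contracts p p
| contracts_step p q r : contract1 p q -> contracts q r -> contracts p r.

Lemma contracts_trans X Y (p q r : gpath X Y) :
  contracts p q -> contracts q r -> contracts p r.
Proof.
by elim=> {p q} [//|p q s pq _ IH sr]; apply: contracts_step pq _; exact: IH.
Qed.

Lemma contract1_catr X Y Z (p p' : gpath X Y) (q : gpath Y Z) :
  contract1 p p' -> contract1 (pcat p q) (pcat p' q).
Proof.
move=> pp; elim: pp q => {X Y p p'} [X Y W V f g p q|X Y W f p p' _ IH q] /=.
  exact: contract_here.
exact/contract_there/IH.
Qed.

Lemma contract1_catl X Y Z (p : gpath X Y) (q q' : gpath Y Z) :
  contract1 q q' -> contract1 (pcat p q) (pcat p q').
Proof. by elim: p q q' => //= X' Y' Z' f p IH q q' /IH; exact: contract_there. Qed.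

Lemma contracts_cat X Y Z (p p' : gpath X Y) (q q' : gpath Y Z) :
  contracts p p' -> contracts q q' -> contracts (pcat p q) (pcat p' q').
Proof.
elim=> {p p'} [p|p r s pr _ IH] qq.
  elim: qq => {q q'} [q|q r s qr _ IH]; first exact: contracts_refl.
  exact: contracts_step (contract1_catl p qr) IH.
exact: contracts_step (contract1_catr q pr) (IH qq).
Qed.

Lemma pcatA X Y Z W (p : gpath X Y) (q : gpath Y Z) (r : gpath Z W) :
  pcat (pcat p q) r = pcat p (pcat q r).
Proof. by elim: p q => //= X' Y' Z' f p IH q; rewrite IH. Qed.

Lemma pcat0 X Y (p : gpath X Y) : pcat p (pnil Y) = p.
Proof. by elim: p => //= X' Y' Z' f p ->. Qed.

Lemma contracts_eq X Y (p q : gpath X Y) : p = q -> contracts p q.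
Proof. by move=> ->; exact: contracts_refl. Qed.

(* Associators and unitors are the identities along the equalities [pcatA] and
   [pcat0]. *)
Definition PathBicat : bicat.
Proof.
refine (@Bicat config gpath contracts pnil pcat contracts_refl contracts_trans
  contracts_cat
  (fun _ _ _ _ p q r => contracts_eq (pcatA p q r))
  (fun _ _ _ _ p q r => contracts_eq (esym (pcatA p q r)))
  (fun _ _ p => contracts_refl p) (fun _ _ p => contracts_refl p)
  (fun _ _ p => contracts_eq (pcat0 p))
  (fun _ _ p => contracts_eq (esym (pcat0 p)))
  _ _ _ _ _ _ _ _ _ _ _ _ _ _ _ _).
all: by move=> *; exact: Prop_irrelevance.
Defined.

Lemma contract2 X Y Z (f : mor X Y) (g : mor Y Z) :
  contracts (path2 f g) (path1 (mor_comp g f)).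
Proof. exact: contracts_step (contract_here f g _) (contracts_refl _). Qed.

Definition alpha X Y Z (f : mor X Y) (g : mor Y Z) :
  @cell PathBicat X Z (path2 f g) (path1 (mor_comp g f)) := contract2 f g.

(* The elements of the product of the groups Sym_{f_{i+1}}(X_i); the tuple
   (sigma_0, ..., sigma_{k-1}) is (sigma_0, (..., (sigma_{k-1}, tt))). *)
Fixpoint tuples X Y (p : gpath X Y) : groupType :=
  match p with
  | pnil _ => unit_grp
  | pcons _ _ _ f p' => (SymfG f * tuples p')%type
  end.

Definition starts_with X Y (p : gpath X Y) : SymG X -> pred (tuples p) :=
  match p in gpath X Y return SymG X -> pred (tuples p) with
  | pnil _ => fun _ _ => true
  | pcons _ _ _ f p' => fun s t => s == Symf_incl t.1
  end.

(* f_{i+1}^sharp(sigma_i) = sigma_{i+1} for 0 <= i <= k-2. *)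
Fixpoint compatible X Y (p : gpath X Y) : pred (tuples p) :=
  match p in gpath X Y return pred (tuples p) with
  | pnil _ => fun _ => true
  | pcons _ _ _ f p' => fun t =>
      @starts_with _ _ p' (sharp t.1) t.2 && @compatible _ _ p' t.2
  end.

(* f_k^sharp(sigma_{k-1}), or s if the path is empty *)
Fixpoint last_sharp X Y (p : gpath X Y) : SymG X -> tuples p -> SymG Y :=
  match p in gpath X Y return SymG X -> tuples p -> SymG Y with
  | pnil _ => fun s _ => s
  | pcons _ _ _ f p' => fun _ t => last_sharp (sharp t.1) t.2
  end.

Lemma Symf_inclF (X Y : config) (f : mor X Y) :
  {morph @Symf_incl X Y f : s t / s * t^-1}.
Proof. by move=> s t; apply: val_inj. Qed.

Lemma sharpF (X Y : config) (f : mor X Y) : {morph @sharp X Y f : s t / s * t^-1}.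
Proof. exact: (gmulfF (mk_hom (@sharpM X Y f))). Qed.

Lemma starts_withF X Y (p : gpath X Y) s s' t t' :
  @starts_with X Y p s t -> @starts_with X Y p s' t' ->
  @starts_with X Y p (s * s'^-1) (t * t'^-1).
Proof.
case: p s s' t t' => //= X0 Y0 Z0 f p s s' t t' /eqP-> /eqP->.
by rewrite Symf_inclF.
Qed.

Lemma starts_with1 X Y (p : gpath X Y) : @starts_with X Y p 1 1.
Proof. by case: p => //= X0 Y0 Z0 f p; apply/eqP/val_inj. Qed.

Lemma sharp1 (X Y : config) (f : mor X Y) : sharp (1 : SymfG f) = 1.
Proof. by apply: val_inj; exact: mor_conj1. Qed.

Lemma compatible_closed X Y (p : gpath X Y) : group_closed (@compatible X Y p).
Proof.
elim: p => [X0|X0 Y0 Z0 f p0 [IH1 IHF]]; first by split.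
split=> [|t t']; rewrite !unfold_in /=.
  by rewrite sharp1 starts_with1.
move=> /andP[ts tc] /andP[ts' tc']; rewrite sharpF starts_withF //=.
exact: IHF.
Qed.

(* G_gamma for a nonempty path; Sym_span treats the empty path separately. *)
Definition Ggrp X Y (p : gpath X Y) : groupType :=
  sub_grp (compatible_closed p).

Lemma last_sharpM X Y (p : gpath X Y) s s' t t' :
  @last_sharp X Y p (s * s') (t * t')
  = @last_sharp X Y p s t * @last_sharp X Y p s' t'.
Proof.
elim: p s s' t t' => //= X0 Y0 Z0 f p IH _ _ t t'.
by rewrite sharpM IH.
Qed.

Section ConsLegs.
Variables (X Y Z : config) (f : mor X Y) (p : gpath Y Z).

(* sigma_0 as a permutation of X_0 *)
Definition sigma0 (t : Ggrp (pcons f p)) : {perm X} := sgval (val t).1.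

(* gamma^flat and gamma^sharp *)
Definition path_flat (t : Ggrp (pcons f p)) : SymG X := Symf_incl (val t).1.
Definition path_sharp (t : Ggrp (pcons f p)) : SymG Z :=
  last_sharp (sharp (val t).1) (val t).2.

Lemma path_flatM : {morph path_flat : t t' / t * t'}.
Proof. by move=> t t'; exact: Symf_inclM. Qed.
Lemma path_sharpM : {morph path_sharp : t t' / t * t'}.
Proof. by move=> t t'; rewrite /path_sharp /= sharpM last_sharpM. Qed.

Definition cons_span : span (SymG X) (SymG Z) :=
  Span (mk_hom path_flatM) (mk_hom path_sharpM).
End ConsLegs.

Definition Sym_span X Y (p : gpath X Y) : span (SymG X) (SymG Y) :=
  match p in gpath X Y return span (SymG X) (SymG Y) with
  | pnil X => span_id (SymG X)
  | pcons _ _ _ f p' => cons_span f p'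
  end.
End Configurations.

(* Main.v *)
Require Import Defs.
From mathcomp Require Import all_boot all_fingroup.
From mathcomp Require Import finmap boolp.
From mathcomp Require Import all_reals topology.

Set Implicit Arguments.
Unset Strict Implicit.
Unset Printing Implicit Defensive.

(** A span [s] from [G] to [H] relates [a : G] to [b : H] when some element of
    its apex lies over both, and a 2-cell [s => t] forces the relation of
    [s] to be contained in that of [t]. The spans of [Sym] have an injective left leg:
    a compatible tuple is determined by its first entry, since each entry is
    the conjugate of the preceding one. For such a target span [t] nothing is
    lost in passing to relations: there is at most one 2-cell [s => t]
    ([mono_cell_eq]), and there is one as soon as the relation of [s] is
    contained in that of [t] ([mono_cell]).

    Every coherence law of a lax functor equates two 2-cells into a span of
    [Sym], so all of them hold by uniqueness. What remains is the existence of
    the 2-cells, which is a question about relations. The relation of a path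
    ([carries]) takes [a] to its conjugate along the whole path, provided that
    the conjugates along all initial segments are symmetries as well. Composing spans composes relations, so
    concatenation of paths gives the composition constraint ([carries_cat]);
    contracting [(f, g)] to [g \o f] only drops the requirement that the
    intermediate conjugate by [f] be a symmetry, so it enlarges the relation
    ([carries_contracts]). *)

Section MonoSpans.
Variables (G H : groupType).

Definition span_rel (s : span G H) (a : G) (b : H) : Prop :=
  exists x : apex s, lleg s x = a /\ rleg s x = b.

Lemma mono_cell_eq (s t : span G H) (u v : span_cell s t) :
  injective (lleg t) -> u = v.
Proof. by move=> tI; apply: span_cell_eq => x; apply: tI; rewrite !span_mapl. Qed.

Section MonoCell.
Variables (s t : span G H) (tI : injective (lleg t)).
Hypothesis st : forall x : apex s, span_rel t (lleg s x) (rleg s x).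

Definition mono_map (x : apex s) : apex t := projT1 (cid (st x)).

Lemma mono_mapl x : lleg t (mono_map x) = lleg s x.
Proof. by rewrite /mono_map; case: cid => y []. Qed.

Lemma mono_mapr x : rleg t (mono_map x) = rleg s x.
Proof. by rewrite /mono_map; case: cid => y []. Qed.

(** The chosen lifts multiply correctly because they are unique. *)
Lemma mono_mapM : {morph mono_map : x y / (x * y)%g}.
Proof. by move=> x y; apply: tI; rewrite grp_homM !mono_mapl grp_homM. Qed.

Definition mono_cell : span_cell s t := mk_cell mono_mapM mono_mapl mono_mapr.
End MonoCell.
End MonoSpans.

Section Paths.
Variables (R : realType) (M : metricType R) (n : nat).
Implicit Types X Y Z W : config M n.

(** The relation of [Sym_span p], by recursion on [p]: it treats the empty path
    and nonempty ones alike, unlike the apex of the span. *)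
Fixpoint carries X Y (p : gpath X Y) : SymG X -> SymG Y -> Prop :=
  match p in gpath X Y return SymG X -> SymG Y -> Prop with
  | pnil _ => fun a b => a = b
  | pcons _ _ _ f p' => fun a b =>
      exists2 s : SymfG f, Symf_incl s = a & carries p' (sharp s) b
  end.

Lemma Symf_incl_inj X Y (f : mor X Y) : injective (@Symf_incl _ _ _ X Y f).
Proof. by move=> s t /(congr1 val) st; apply: val_inj. Qed.

Lemma compatible_inj X Y (p : gpath X Y) (a : SymG X) (t t' : tuples p) :
  starts_with a t -> starts_with a t' -> compatible t -> compatible t' ->
  t = t'.
Proof.
elim: p a t t' => [X0 a [] []//|X0 Y0 Z0 f p IH a [s t] [s' t']] /=.
move=> /eqP-> /eqP /Symf_incl_inj <- /andP[st ct] /andP[st' ct'].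
by rewrite (IH _ _ _ st st' ct ct').
Qed.

Lemma Sym_span_mono X Y (p : gpath X Y) : injective (lleg (Sym_span p)).
Proof.
case: p => [X0 a b //|X0 Y0 Z0 f p] t t' /= tt'.
apply: val_inj; apply: (@compatible_inj _ _ (pcons f p) (path_flat t)).
- exact: eqxx.
- by apply/eqP; exact: tt'.
- exact: (valP t).
- exact: (valP t').
Qed.

Lemma carriesP X Y (p : gpath X Y) (a : SymG X) (b : SymG Y) :
  carries p a b <->
  exists t : tuples p, [/\ starts_with a t, compatible t & last_sharp a t = b].
Proof.
elim: p a b => [X0 a b|X0 Y0 Z0 f p IH a b] /=.
  by split=> [->|[_ []]//]; exists tt.
split=> [[s <- /IH [t [st ct lt]]]|[[s t] /= [/eqP-> /andP[st ct] lt]]].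
  by exists (s, t); rewrite /= eqxx st ct lt.
by exists s => //; apply/IH; exists t.
Qed.

Lemma span_rel_Sym X Y (p : gpath X Y) (a : SymG X) (b : SymG Y) :
  span_rel (Sym_span p) a b <-> carries p a b.
Proof.
case: p a b => [X0 a b|X0 Y0 Z0 f p a b].
  by split=> [[x [<- <-]]|->] //; exists b.
split=> [[x [<- <-]]|/carriesP [t [st ct lt]]].
  apply/carriesP; exists (val x); split => //; first exact: eqxx.
  exact: (valP x).
exists (exist _ t ct); split=> //.
by apply/esym/eqP; exact: st.
Qed.

Lemma carries_cat X Y Z (p : gpath X Y) (q : gpath Y Z) a b c :
  carries p a b -> carries q b c -> carries (pcat p q) a c.
Proof.
elim: p q a b => [X0 q a b -> //|X0 Y0 Z0 f p IH q a b [s <- pb] qc] /=.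
by exists s => //; exact: IH pb qc.
Qed.

Lemma mor_conj_comp X Y Z (g : mor Y Z) (f : mor X Y) (s : {perm X}) :
  mor_conj (mor_comp g f) s = mor_conj g (mor_conj f s).
Proof.
apply/permP => z; rewrite !permE /=; congr (g (f (s _))).
apply: (bij_inj (mor_bij (mor_comp g f))).
by rewrite mor_invK /= !mor_invK.
Qed.

(** Conjugating by [mor_comp g f] is conjugating by [f], then by [g]; so an
    element of [Symf f] whose conjugate lies in [Symf g] already lies in
    [Symf (mor_comp g f)]. This is the inclusion of the fibre product. *)
Lemma carries_contract1 X Y (p q : gpath X Y) a b :
  contract1 p q -> carries p a b -> carries q a b.
Proof.
move=> pq; elim: pq a b => {X Y p q} [X Y Z W f g p a b|X Y Z f p q _ IH a b] /=.
  move=> [s sa [t ts pb]].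
  have tE : mor_conj f (sgval s) = sgval t by exact: esym (congr1 val ts).
  have sP : sgval s \in Symf (mor_comp g f).
    by apply/setIdP; split; [exact: Symf_sub | rewrite mor_conj_comp tE Symf_conj].
  exists (Subg sP); first by rewrite -sa; exact: val_inj.
  suff -> : sharp (Subg sP) = sharp t by [].
  by apply: val_inj; rewrite /= mor_conj_comp tE.
by move=> [s sa pb]; exists s => //; exact: IH.
Qed.

Lemma carries_contracts X Y (p q : gpath X Y) a b :
  contracts p q -> carries p a b -> carries q a b.
Proof. by elim=> // {}p r {}q pr _ IH /(carries_contract1 pr). Qed.

Lemma Sym_rel X Y (p : gpath X Y) (x : apex (Sym_span p)) :
  carries p (lleg _ x) (rleg _ x).
Proof. by apply/span_rel_Sym; exists x. Qed.

Lemma Sym_rel_contracts X Y (p q : gpath X Y) (pq : contracts p q)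
    (x : apex (Sym_span p)) :
  span_rel (Sym_span q) (lleg _ x) (rleg _ x).
Proof. exact/span_rel_Sym/(carries_contracts pq)/Sym_rel. Qed.

Lemma Sym_rel_cat X Y Z (p : gpath X Y) (q : gpath Y Z)
    (x : apex (span_comp (Sym_span p) (Sym_span q))) :
  span_rel (Sym_span (pcat p q)) (lleg _ x) (rleg _ x).
Proof.
apply/span_rel_Sym/carries_cat; first exact: Sym_rel.
by rewrite pbP; exact: Sym_rel.
Qed.

Definition Sym2 X Y (p q : gpath X Y) (pq : contracts p q) :
    span_cell (Sym_span p) (Sym_span q) :=
  mono_cell (@Sym_span_mono _ _ q) (Sym_rel_contracts pq).

Definition Sym_comp X Y Z (p : gpath X Y) (q : gpath Y Z) :
    span_cell (span_comp (Sym_span p) (Sym_span q)) (Sym_span (pcat p q)) :=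
  mono_cell (@Sym_span_mono _ _ (pcat p q)) (@Sym_rel_cat _ _ _ p q).

Definition Sym_lax :
  @lax_functor (PathBicat M n) SpanGrp (@SymG R M n) (@Sym_span R M n).
Proof.
refine (@LaxFunctor (PathBicat M n) SpanGrp (@SymG R M n) (@Sym_span R M n)
  Sym2 (fun X => span_id2 (span_id (SymG X))) Sym_comp _ _ _ _ _ _).
all: by move=> *; apply: mono_cell_eq; exact: Sym_span_mono.
Defined.

End Paths.

Theorem theorem1p3p4 (R : realType) (M : metricType R) (n : nat)
    (hn : (2 <= n)%N) :
  exists F : @lax_functor (PathBicat M n) SpanGrp
               (@SymG R M n) (@Sym_span R M n),
    is_normal F /\
    forall (X Y Z : config M n) (f : mor X Y) (g : mor Y Z)
      (t : apex (Sym_span (path2 f g))),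
      let i : span_cell (Sym_span (path2 f g))
                        (Sym_span (path1 (mor_comp g f))) :=
        lax2 F (alpha f g) in
      sigma0 (i t) = sigma0 t.
Proof.
exists (@Sym_lax R M n); split=> [X|X Y Z f g t i]; first by exists erefl.
(* Both sides are the underlying permutations of the left legs. *)
exact: (congr1 val (span_mapl i t)).
Qed.
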